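(* Let $\mathcal{H}$ be a Hilbert space. Let $H:\mathcal{H}\to\mathcal{H}$ be strongly monotone with constant $\gamma>0$ and Lipschitz continuous with constant $\tau>0$. Let $A:\mathcal{H}\to\mathcal{H}$ be Lipschitz continuous with constant $s>0$ and strongly monotone with respect to $H$ with constant $r>0$. Let $M:\mathcal{H}\to 2^{\mathcal{H}}$ be a strongly $H$-monotone operator with constant $\eta>0$. Suppose there exists a constant $\lambda>0$ such that $$\left|\lambda-\frac{r+\gamma\eta}{s^2-\eta^2}\right|<\frac{\sqrt{(r+\gamma\eta)^2-(s^2-\eta^2)(\tau^2-\gamma^2)}}{s^2-\eta^2},\qquad (r+\gamma\eta)^2>(s^2-\eta^2)(\tau^2-\gamma^2),\qquad s>\eta.$$ Let $\{\mu_n\}_{n\ge 0}\subset[0,1]$ be a real sequence with $\sum_{n=0}^{\infty}\mu_n=\infty$, let $s_0\in\mathcal{H}$, and define for all $n\in\mathbb{N}$ $$t_n=(1-\mu_n)s_n+\mu_n R^{H}_{M,\lambda}[Hs_n-\lambda As_n],\qquad s_{n+1}=R^{H}_{M,\lambda}[Ht_n-\lambda At_n].$$ Then the sequence $\{s_n\}$ converges strongly to the unique solution $x^*\in\mathcal{H}$ of the variational inclusion problem: find $u\in\mathcal{H}$ such that $0\in A(u)+M(u)$.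
   Context: $\mathbb{N}=\{0,1,2,\dots\}$; $2^{\mathcal{H}}$ is the family of all nonempty subsets of $\mathcal{H}$; $\langle\cdot,\cdot\rangle$ and $\|\cdot\|$ are the inner product and norm of $\mathcal{H}$. An operator $T:\mathcal{H}\to\mathcal{H}$ is strongly monotone with constant $c>0$ if $\langle Tx-Ty,x-y\rangle\ge c\|x-y\|^2$ for all $x,y\in\mathcal{H}$; it is strongly monotone with respect to $H:\mathcal{H}\to\mathcal{H}$ with constant $c>0$ if $\langle Tx-Ty,Hx-Hy\rangle\ge c\|x-y\|^2$ for all $x,y\in\mathcal{H}$; it is Lipschitz continuous with constant $c>0$ if $\|Tx-Ty\|\le c\|x-y\|$ for all $x,y\in\mathcal{H}$. A multivalued operator $M:\mathcal{H}\to 2^{\mathcal{H}}$ is strongly monotone with constant $\eta>0$ if $\langle x-y,u-v\rangle\ge\eta\|u-v\|^2$ for all $u,v\in\mathcal{H}$, $x\in Mu$, $y\in Mv$. It is strongly $H$-monotone (with constant $\eta$) if it is strongly monotone (with constant $\eta$) and $(H+\lambda M)(\mathcal{H})=\mathcal{H}$ for all $\lambda>0$. The resolvent operator $R^{H}_{M,\lambda}:\mathcal{H}\to\mathcal{H}$ is $R^{H}_{M,\lambda}(u)=(H+\lambda M)^{-1}(u)$; it is a well-defined single-valued map when $H$ is continuous and strongly monotone and $M$ is strongly $H$-monotone. *)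

(* Defs.v *)
From mathcomp Require Import all_boot all_order all_algebra.
From mathcomp Require Import all_classical all_reals all_analysis.

Set Implicit Arguments.
Unset Strict Implicit.
Unset Printing Implicit Defensive.

Import Order.TTheory GRing.Theory Num.Theory.
Import numFieldNormedType.Exports.

Local Open Scope classical_set_scope.
Local Open Scope ring_scope.

(* A real Hilbert space is a complete normed module [V] over the reals together
   with a dot product [dot : {dot V for idfun}] (symmetric, bilinear, positive
   definite) that induces the norm of [V]. *)
Definition dot_induces_norm (R : realType) (V : completeNormedModType R)
    (dot : {dot V for idfun}) : Prop :=
  forall x : V, `|x| = Num.sqrt (dot x x).

Definition strongly_monotone (R : realType) (V : completeNormedModType R)
    (dot : {dot V for idfun}) (T : V -> V) (c : R) : Prop :=
  forall x y : V, c * `|x - y| ^+ 2 <= dot (T x - T y) (x - y).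

Definition strongly_monotone_wrt (R : realType) (V : completeNormedModType R)
    (dot : {dot V for idfun}) (H T : V -> V) (c : R) : Prop :=
  forall x y : V, c * `|x - y| ^+ 2 <= dot (T x - T y) (H x - H y).

Definition lipschitz_continuous (R : realType) (V : completeNormedModType R)
    (T : V -> V) (c : R) : Prop :=
  forall x y : V, `|T x - T y| <= c * `|x - y|.

(* Multivalued operators are maps [M : V -> set V].  The empty set is not an
   admissible value: nonemptiness of every [M u] is the separate predicate
   [nonempty_valued]. *)
Definition nonempty_valued (R : realType) (V : completeNormedModType R)
    (M : V -> set V) : Prop :=
  forall u : V, M u !=set0.

Definition mv_strongly_monotone (R : realType) (V : completeNormedModType R)
    (dot : {dot V for idfun}) (M : V -> set V) (eta : R) : Prop :=
  forall u v x y : V, M u x -> M v y ->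
    eta * `|u - v| ^+ 2 <= dot (x - y) (u - v).

Definition mv_scale (R : realType) (V : completeNormedModType R)
    (lambda : R) (M : V -> set V) : V -> set V :=
  fun u => [set lambda *: x | x in M u].

Definition mv_add (R : realType) (V : completeNormedModType R)
    (T : V -> V) (M : V -> set V) : V -> set V :=
  fun u => [set T u + x | x in M u].

Definition mv_range (R : realType) (V : completeNormedModType R)
    (M : V -> set V) : set V :=
  \bigcup_(u in [set: V]) M u.

Definition mv_inverse (R : realType) (V : completeNormedModType R)
    (M : V -> set V) : V -> set V :=
  fun v => [set u | M u v].

Definition strongly_H_monotone (R : realType) (V : completeNormedModType R)
    (dot : {dot V for idfun}) (H : V -> V) (M : V -> set V) (eta : R) : Prop :=
  mv_strongly_monotone dot M eta /\
  forall lambda : R, 0 < lambda ->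
    mv_range (mv_add H (mv_scale lambda M)) = [set: V].

(* [resolvent H M lambda u] is the element of [(H + lambda M)^-1 u].  This set
   is a singleton when [H] is continuous and strongly monotone and [M] is
   strongly [H]-monotone; [0] is a junk value used only when it is empty. *)
Definition resolvent (R : realType) (V : completeNormedModType R)
    (H : V -> V) (M : V -> set V) (lambda : R) (u : V) : V :=
  xget 0 (mv_inverse (mv_add H (mv_scale lambda M)) u).

Definition variational_inclusion_solution (R : realType)
    (V : completeNormedModType R) (A : V -> V) (M : V -> set V) (u : V) : Prop :=
  mv_add A M u 0.

(* Main.v *)
Require Import Defs.
From mathcomp Require Import all_boot all_order all_algebra.
From mathcomp Require Import all_classical all_reals all_analysis.
From mathcomp Require Import ring lra.
Import Order.TTheory GRing.Theory Num.Theory.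
Import numFieldNormedType.Exports.
Local Open Scope classical_set_scope.
Local Open Scope ring_scope.

Set Implicit Arguments.
Unset Strict Implicit.
Unset Printing Implicit Defensive.

(** Write [J] for the resolvent [(H + lambda M)^-1].  A vector [u] satisfies
    [0 \in A u + M u] exactly when [H u - lambda A u \in H u + lambda M u], that
    is, when [u] is a fixed point of [F u = J (H u - lambda A u)]
    ([solution_fixed_point]).  So it is enough to see that [F] is a contraction.

    The operator [H + lambda M] is strongly monotone with constant
    [gamma + lambda eta], hence expands distances by at least that factor, and
    [J] is Lipschitz with the inverse constant ([resolvent_lipschitz]).
    Expanding [|(H x - H y) - lambda (A x - A y)|^2] shows that the forward step
    [H - lambda A] is Lipschitz with constant
    [sqrt (tau^2 - 2 lambda r + lambda^2 s^2)] ([forward_step_lipschitz]).  The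
    product [theta] of the two constants is less than [1] iff
    [(s^2 - eta^2) lambda^2 - 2 (r + gamma eta) lambda + tau^2 - gamma^2 < 0],
    and the assumption on [lambda] says precisely that [lambda] lies strictly
    between the two roots of this quadratic ([contraction_factor_lt1]).

    Banach's theorem then gives the unique fixed point [xstar].  Since [t_ n]
    is a convex combination of [s_ n] and [F (s_ n)], both within
    [|s_ n - xstar|] of [xstar], the averaging step does not increase the
    distance to [xstar], and the step [s_ n.+1 = F (t_ n)] multiplies it by at
    most [theta]; the convergence is therefore geometric
    ([averaged_iteration_cvg]). *)

Section DotNorm.
Context (R : realType) (V : completeNormedModType R) (dot : {dot V for idfun}).
Hypothesis dot_norm : dot_induces_norm dot.

Lemma dotC u v : dot u v = dot v u.
Proof. by rewrite hermC expr0 mul1r. Qed.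

Lemma dot_sqr_norm u : dot u u = `|u| ^+ 2.
Proof.
have dot_ge0 : 0 <= dot u u.
  by have [->|/(neq0_dnorm_gt0 (s := dot))/ltW//] := eqVneq u 0; rewrite linear0l.
by rewrite dot_norm sqr_sqrtr.
Qed.

Lemma sqr_normB_scale (l : R) u v :
  `|u - l *: v| ^+ 2 = `|u| ^+ 2 - 2 * l * dot v u + l ^+ 2 * `|v| ^+ 2.
Proof.
rewrite -!dot_sqr_norm linearBl !linearBr !(linearZl_LR dot) !(linearZr_LR dot) /=.
by rewrite (dotC u v); ring.
Qed.

(** Cauchy-Schwarz comes for free here: the norm of [V] already satisfies the
    triangle inequality, whose square is this bound after expansion. *)
Lemma dot_le_norm u v : dot u v <= `|u| * `|v|.
Proof.
have : `|u - (- 1) *: v| ^+ 2 <= (`|u| + `|v|) ^+ 2.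
  by rewrite ler_sqr ?nnegrE ?addr_ge0// scaleN1r opprK ler_normD.
rewrite sqr_normB_scale (dotC v u); nra.
Qed.
End DotNorm.

Section Resolvent.
Context (R : realType) (V : completeNormedModType R) (dot : {dot V for idfun}).
Hypothesis dot_norm : dot_induces_norm dot.
Context (H A : V -> V) (M : V -> set V) (gamma eta lambda : R).
Hypotheses (gamma_gt0 : 0 < gamma) (eta_gt0 : 0 < eta) (lambda_gt0 : 0 < lambda).
Hypotheses (H_mono : strongly_monotone dot H gamma)
  (M_mono : strongly_H_monotone dot H M eta).

Let coef_gt0 : 0 < gamma + lambda * eta.
Proof. by rewrite addr_gt0 ?mulr_gt0. Qed.

(** Pairing [u - v] with [x - y] collects the strong monotonicity of [H] and of
    [lambda M]; Cauchy-Schwarz then lets one factor [|x - y|] be cancelled.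
    Taking [u = v] gives the injectivity that makes the resolvent
    single-valued. *)
Lemma mv_add_scale_expansive x y u v :
  mv_add H (mv_scale lambda M) x u -> mv_add H (mv_scale lambda M) y v ->
  (gamma + lambda * eta) * `|x - y| <= `|u - v|.
Proof.
move=> [_ [a Ma <-] <-] [_ [b Mb <-] <-].
set d := (H x + _ - _).
have le_dot : (gamma + lambda * eta) * `|x - y| ^+ 2 <= dot d (x - y).
  have -> : d = (H x - H y) + lambda *: (a - b).
    by rewrite /d scalerBr opprD addrACA.
  rewrite (linearDl dot) (linearZl_LR dot) /= mulrDl -mulrA lerD//.
  by rewrite ler_pM2l//; exact: M_mono.1.
have [->|xy] := eqVneq x y; first by rewrite subrr normr0 mulr0.
have n_gt0 : 0 < `|x - y| by rewrite normr_gt0 subr_eq0.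
rewrite -(ler_pM2r n_gt0) -mulrA -expr2.
by apply: le_trans le_dot _; exact: dot_le_norm.
Qed.

(** The range condition on [H + lambda M] excludes the default value in the
    definition of [resolvent]. *)
Lemma resolventP u : mv_add H (mv_scale lambda M) (resolvent H M lambda u) u.
Proof.
apply: (@xgetPex V 0 (mv_inverse (mv_add H (mv_scale lambda M)) u)).
have : [set: V] u by [].
by rewrite -(M_mono.2 _ lambda_gt0) => -[x _ ?]; exists x.
Qed.

Lemma resolvent_lipschitz :
  lipschitz_continuous (resolvent H M lambda) (gamma + lambda * eta)^-1.
Proof.
move=> u v; rewrite ler_pdivlMl//.
exact: mv_add_scale_expansive (resolventP u) (resolventP v).
Qed.

Lemma resolvent_eq x u :
  mv_add H (mv_scale lambda M) x u -> resolvent H M lambda u = x.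
Proof.
move=> /(mv_add_scale_expansive (resolventP u)).
rewrite subrr normr0 pmulr_rle0// normr_le0 subr_eq0.
by move/eqP.
Qed.

(** Multiply [0 = A u + a], with [a \in M u], by [lambda] and add [H u]:
    [H u - lambda A u = H u + lambda a]. *)
Lemma solution_fixed_point u :
  variational_inclusion_solution A M u <->
  u = resolvent H M lambda (H u - lambda *: A u).
Proof.
split.
  move=> [a Ma] /eqP; rewrite addrC addr_eq0 => /eqP aE.
  apply/esym/resolvent_eq; exists (lambda *: a); first by exists a.
  by rewrite aE scalerN.
move=> uE; have := resolventP (H u - lambda *: A u).
rewrite -uE => -[_ [a Ma <-]] /addrI /eqP.
rewrite -scalerN (inj_eq (scalerI (lt0r_neq0 lambda_gt0))) => /eqP aE.
by exists a => //; rewrite aE subrr.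
Qed.
End Resolvent.

(** In the expansion of the squared norm, monotonicity of [A] with respect to
    [H] bounds the cross term and the Lipschitz bounds control the squares.
    If the radicand is negative, then [Num.sqrt] is [0]; this is consistent,
    since the same inequality forces [x = y]. *)
Lemma forward_step_lipschitz (R : realType) (V : completeNormedModType R)
    (dot : {dot V for idfun}) (H A : V -> V) (tau s r lambda : R) :
  dot_induces_norm dot -> 0 <= lambda ->
  lipschitz_continuous H tau -> lipschitz_continuous A s ->
  strongly_monotone_wrt dot H A r ->
  lipschitz_continuous (fun x => H x - lambda *: A x)
    (Num.sqrt (tau ^+ 2 - 2 * lambda * r + lambda ^+ 2 * s ^+ 2)).
Proof.
move=> dot_norm l_ge0 H_lip A_lip A_mono x y.
set c := tau ^+ 2 - _ + _; set e := `|x - y|.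
have lip_sqr T k : lipschitz_continuous T k ->
    `|T x - T y| ^+ 2 <= k ^+ 2 * e ^+ 2.
  by move=> T_lip; rewrite -exprMn lerXn2r ?nnegrE// (le_trans _ (T_lip x y)).
have -> : H x - lambda *: A x - (H y - lambda *: A y) =
    (H x - H y) - lambda *: (A x - A y).
  by rewrite scalerBr !opprD addrACA.
have le_sqr : `|(H x - H y) - lambda *: (A x - A y)| ^+ 2 <= e ^+ 2 * c.
  rewrite (sqr_normB_scale dot_norm).
  have := lip_sqr _ _ H_lip.
  have := ler_wpM2l (sqr_ge0 lambda) (lip_sqr _ _ A_lip).
  have := ler_wpM2l l_ge0 (A_mono x y).
  rewrite -/e /c; lra.
rewrite -(ger0_norm (normr_ge0 (_ - _ *: _))) -sqrtr_sqr.
rewrite [leRHS]mulrC -[e]ger0_norm ?normr_ge0// -sqrtr_sqr -sqrtrM ?sqr_ge0//.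
exact: ler_wsqrtr.
Qed.

(** After squaring, both the assumption on [lambda] and the conclusion are the
    statement that [q lambda^2 - 2 p lambda + (tau^2 - gamma^2)] is negative,
    where [p = r + gamma eta] and [q = s^2 - eta^2]: completing the square
    turns [q] times this quadratic into [(q lambda - p)^2 - D]. *)
Lemma contraction_factor_lt1 (R : realType) (gamma tau s r eta lambda : R) :
  0 < gamma -> 0 < eta -> 0 < lambda -> eta < s ->
  (s ^+ 2 - eta ^+ 2) * (tau ^+ 2 - gamma ^+ 2) < (r + gamma * eta) ^+ 2 ->
  `|lambda - (r + gamma * eta) / (s ^+ 2 - eta ^+ 2)| <
    Num.sqrt ((r + gamma * eta) ^+ 2 -
              (s ^+ 2 - eta ^+ 2) * (tau ^+ 2 - gamma ^+ 2)) /
    (s ^+ 2 - eta ^+ 2) ->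
  (gamma + lambda * eta)^-1 *
    Num.sqrt (tau ^+ 2 - 2 * lambda * r + lambda ^+ 2 * s ^+ 2) < 1.
Proof.
move=> g0 e0 l0 es; set p := r + _; set q := s ^+ 2 - eta ^+ 2.
set D := p ^+ 2 - _ => disc; have D0 : 0 <= D by rewrite subr_ge0 ltW.
have q0 : 0 < q by rewrite /q; nra.
rewrite ltr_pdivlMr// -[X in `|_| * X](gtr0_norm q0) -normrM => lt_sqrt.
have lt_sqr : (lambda * q - p) ^+ 2 < D.
  rewrite -(sqr_sqrtr D0) -real_normK ?num_real//.
  rewrite ltr_pXn2r ?nnegrE ?sqrtr_ge0//.
  by move: lt_sqrt; rewrite mulrBl divfK ?gt_eqF.
have quad_lt0 : q * lambda ^+ 2 - 2 * lambda * p + (tau ^+ 2 - gamma ^+ 2) < 0.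
  by rewrite -(pmulr_rlt0 _ q0); move: lt_sqr; rewrite /D; lra.
have k0 : 0 < gamma + lambda * eta by rewrite addr_gt0 ?mulr_gt0.
rewrite ltr_pdivrMl// mulr1 -[ltRHS]gtr0_norm// -sqrtr_sqr.
rewrite ltr_sqrt ?exprn_gt0//.
by move: quad_lt0; rewrite /q /p; lra.
Qed.

Section Contraction.
Context (R : realType) (V : completeNormedModType R) (F : V -> V) (theta : R).
Hypotheses (theta_ge0 : 0 <= theta) (theta_lt1 : theta < 1).
Hypothesis F_lip : lipschitz_continuous F theta.

Lemma lipschitz_fixed_point : exists x, x = F x.
Proof.
have [|||x _ xE] := @banach_fixed_point R V setT [fun of totalfun F].
- exists (NngNum theta_ge0); split => //= -[x y] _ /=.
  exact: F_lip.
- exact: closedT.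
- by exists 0.
- by exists x.
Qed.

Lemma fixed_point_unique x y : x = F x -> y = F y -> x = y.
Proof.
move=> xE yE; apply/eqP; rewrite -subr_eq0 -normr_le0.
rewrite -(@pmulr_rle0 _ (1 - theta)) ?subr_gt0// mulrBl mul1r subr_le0.
by have := F_lip x y; rewrite -xE -yE.
Qed.

(** The averaging step is nonexpansive around the fixed point, whatever the
    weights, and each application of [F] contributes a factor [theta]:
    [|s_ n - x| <= theta^n |s_ 0 - x|]. *)
Lemma averaged_iteration_cvg (mu : nat -> R) (s_ t_ : nat -> V) x :
  x = F x -> (forall n, 0 <= mu n <= 1) ->
  (forall n, t_ n = (1 - mu n) *: s_ n + mu n *: F (s_ n)) ->
  (forall n, s_ n.+1 = F (t_ n)) ->
  s_ n @[n --> \oo] --> x.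
Proof.
move=> xE mu_01 t_def s_def.
have le_t n : `|t_ n - x| <= `|s_ n - x|.
  have /andP[mu_ge0 mu_le1] := mu_01 n.
  have -> : t_ n - x = (1 - mu n) *: (s_ n - x) + mu n *: (F (s_ n) - F x).
    rewrite t_def -xE !scalerBr addrACA -opprD -scalerDl.
    by rewrite subrK scale1r.
  apply: le_trans (ler_normD _ _) _.
  rewrite !normrZ !ger0_norm ?subr_ge0//.
  have := F_lip (s_ n) x; have := normr_ge0 (s_ n - x).
  set a := `|s_ n - x|; set b := `|F _ - _| => a_ge0 le_b.
  have {}le_b : b <= a by rewrite (le_trans le_b)// ler_piMl// ltW.
  by have := ler_wpM2l mu_ge0 le_b; lra.
have le_geo n : `|s_ n - x| <= theta ^+ n * `|s_ 0%N - x|.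
  elim: n => [|n IH]; first by rewrite expr0 mul1r.
  rewrite s_def {1}xE (le_trans (F_lip _ _))// exprS -mulrA.
  by rewrite ler_wpM2l// (le_trans (le_t n)).
apply/subr_cvg0/norm_cvg0P.
have theta_norm : `|theta| < 1 by rewrite ger0_norm.
apply: (squeeze_cvgr _ (cvg_cst 0) (cvg_geometric `|s_ 0%N - x| theta_norm)).
by apply: nearW => n; rewrite normr_ge0 /geometric /= mulrC le_geo.
Qed.
End Contraction.

Theorem theorem1 (R : realType) (V : completeNormedModType R)
    (dot : {dot V for idfun}) (dot_norm : dot_induces_norm dot)
    (H A : V -> V) (M : V -> set V) (gamma tau s r eta lambda : R)
    (gamma_gt0 : 0 < gamma) (tau_gt0 : 0 < tau) (s_gt0 : 0 < s) (r_gt0 : 0 < r)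
    (eta_gt0 : 0 < eta) (lambda_gt0 : 0 < lambda)
    (H_mono : strongly_monotone dot H gamma)
    (H_lip : lipschitz_continuous H tau)
    (A_lip : lipschitz_continuous A s)
    (A_mono : strongly_monotone_wrt dot H A r)
    (M_nonempty : nonempty_valued M)
    (M_mono : strongly_H_monotone dot H M eta)
    (lambda_near :
      `|lambda - (r + gamma * eta) / (s ^+ 2 - eta ^+ 2)| <
      Num.sqrt ((r + gamma * eta) ^+ 2 -
                (s ^+ 2 - eta ^+ 2) * (tau ^+ 2 - gamma ^+ 2)) /
      (s ^+ 2 - eta ^+ 2))
    (disc_gt0 : (r + gamma * eta) ^+ 2 >
                (s ^+ 2 - eta ^+ 2) * (tau ^+ 2 - gamma ^+ 2))
    (s_gt_eta : s > eta)
    (mu : nat -> R) (mu_01 : forall n : nat, 0 <= mu n <= 1)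
    (mu_sum : (\sum_(0 <= n <oo) (mu n)%:E = +oo)%E)
    (s_ t_ : nat -> V)
    (t_def : forall n : nat, t_ n =
      (1 - mu n) *: s_ n +
      mu n *: resolvent H M lambda (H (s_ n) - lambda *: A (s_ n)))
    (s_def : forall n : nat, s_ n.+1 =
      resolvent H M lambda (H (t_ n) - lambda *: A (t_ n))) :
  exists xstar : V,
    [/\ variational_inclusion_solution A M xstar,
        forall u : V, variational_inclusion_solution A M u -> u = xstar
      & s_ n @[n --> \oo] --> xstar].
Proof.
pose F x := resolvent H M lambda (H x - lambda *: A x).
pose theta := (gamma + lambda * eta)^-1 *
  Num.sqrt (tau ^+ 2 - 2 * lambda * r + lambda ^+ 2 * s ^+ 2).
have k_gt0 : 0 < gamma + lambda * eta by rewrite addr_gt0 ?mulr_gt0.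
have theta_ge0 : 0 <= theta by rewrite mulr_ge0 ?sqrtr_ge0 ?invr_ge0 ?ltW.
have theta_lt1 : theta < 1 by exact: contraction_factor_lt1.
have F_lip : lipschitz_continuous F theta.
  move=> x y; rewrite /theta -(mulrA _^-1).
  have R_lip := resolvent_lipschitz dot_norm gamma_gt0 eta_gt0 lambda_gt0
    H_mono M_mono.
  apply: le_trans (R_lip _ _) _.
  rewrite ler_pM2l ?invr_gt0//.
  exact: (forward_step_lipschitz dot_norm (ltW lambda_gt0) H_lip A_lip A_mono).
have solE u : variational_inclusion_solution A M u <-> u = F u.
  exact (solution_fixed_point dot_norm A gamma_gt0 eta_gt0 lambda_gt0
    H_mono M_mono u).
have [x xE] := lipschitz_fixed_point theta_ge0 theta_lt1 F_lip.
exists x; split.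
- exact/solE.
- by move=> u /solE uE; exact: fixed_point_unique theta_lt1 F_lip _ _ uE xE.
- exact (averaged_iteration_cvg theta_ge0 theta_lt1 F_lip xE mu_01 t_def s_def).
Qed.
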